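(* Let $X$ be a compactum and let $F\colon X\to 2^X$ be an upper semicontinuous function. If $z\in X$, then $\mathcal{O}_F(z)$ is a closed subset of $X^{\mathbb N}$.
   Context: A compactum is a compact metric space. $2^X$ denotes the family of all nonempty closed subsets of $X$. A function $F\colon X\to 2^X$ is upper semicontinuous if for each $x\in X$ and every open subset $V$ of $X$ with $F(x)\subseteq V$, there is an open subset $U$ of $X$ with $x\in U$ and $F(y)\subseteq V$ for all $y\in U$. $\mathbb N=\{1,2,3,\ldots\}$ and $X^{\mathbb N}$ carries the product topology. For $z\in X$, the orbit set of $z$ is $\mathcal{O}_F(z)=\{(x_n)_{n\in\mathbb N}\in X^{\mathbb N} : x_1=z \text{ and } x_{n+1}\in F(x_n) \text{ for each } n\in\mathbb N\}$. *)

(* Defs.v *)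
From HB Require Import structures.
From mathcomp Require Import all_boot all_order all_algebra.
From mathcomp Require Import all_classical all_reals all_analysis.

Set Implicit Arguments.
Unset Strict Implicit.
Unset Printing Implicit Defensive.

Local Open Scope classical_set_scope.

(* Usually written 2^X. *)
Definition closed_hyperspace (X : topologicalType) : set (set X) :=
  [set A | A !=set0 /\ closed A].

Definition upper_semicontinuous (X : topologicalType) (F : X -> set X) : Prop :=
  forall (x : X) (V : set X), open V -> F x `<=` V ->
    exists U : set X, [/\ open U, U x & forall y, U y -> F y `<=` V].

(* [{ptws nat -> X}] is X^N with the product topology. Sequences are indexed
   from 0, so the first term x_1 of an orbit is [x 0]. *)
Definition orbit_set (X : topologicalType) (F : X -> set X) (z : X) :
    set {ptws nat -> X} :=
  [set x | x 0%N = z /\ forall n : nat, F (x n) (x n.+1)].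

(* Main.v *)
Require Import Defs.
From mathcomp Require Import all_boot all_order all_algebra.
From mathcomp Require Import all_classical all_reals all_analysis.

Local Open Scope classical_set_scope.

(** Orbits are the sequences that start at [z] and whose consecutive pairs all lie in the graph of
    [F]. Coordinates are continuous in the product topology, so closedness of the orbit set reduces
    to closedness of the graph, which is [usc_closed_graph]. *)

(** A point [b] outside the closed set [F a] can be separated from it by regularity, and upper
    semicontinuity keeps the separation for all points near [a]. *)
Lemma usc_closed_graph (X : topologicalType) (F : X -> set X) :
  @regular_space X -> (forall x, closed (F x)) -> upper_semicontinuous F ->
  closed [set p : X * X | F p.1 p.2].
Proof.
move=> regX Fcl Fusc [a b] clab /=; apply: contrapT => nFab.
have [|U Ub UF] := regX b (~` F a).
  by apply: open_nbhs_nbhs; split => //; exact: closed_openC.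
(* The complement of [closure U] is an open set containing [F a], so all values of [F] on [W] avoid
   [U]: the neighbourhood [W]*[U] of [(a, b)] misses the graph. *)
have [||W [Wo Wa WU]] := Fusc a (~` closure U).
- exact/closed_openC/closed_closure.
- by move=> c Fac /UF.
have [|[c d] /= [Fcd [Wc Ud]]] := clab (W `*` U).
  by exists (W, U) => //; split => //; exact: open_nbhs_nbhs.
exact: WU Wc d Fcd (subset_closure Ud).
Qed.

Theorem theorem3p11 (R : realType) (X : metricType R)
  (X_compact : compact [set: X])
  (F : X -> set X) (F_closed_hyperspace : forall x : X, closed_hyperspace (F x))
  (F_usc : upper_semicontinuous F) (z : X) :
  closed (orbit_set F z).
Proof.
have coord n : continuous (fun x : {ptws nat -> X} => x n).
  exact: (@proj_continuous nat (fun=> X) n).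
(* Each condition on an orbit involves only one or two coordinates, so it is the preimage of a
   closed set under a continuous map. *)
have -> : orbit_set F z = (fun x : {ptws nat -> X} => x 0%N) @^-1` [set z] `&`
    \bigcap_n (fun x : {ptws nat -> X} => (x n, x n.+1)) @^-1`
                [set p : X * X | F p.1 p.2].
  by apply/seteqP; split=> x [x0 xF]; split=> // n; [move=> _|]; exact: xF.
apply: closedI.
  apply: preimage_closed => [x _|]; first exact: coord.
  exact/accessible_closed_set1/hausdorff_accessible/metric_hausdorff.
apply: closed_bigI => n _; apply: preimage_closed => [x _|].
  exact: (cvg_pair (coord n x) (coord n.+1 x)).
apply: usc_closed_graph F_usc; first exact: uniform_regular.
by move=> x; have [] := F_closed_hyperspace x.
Qed.
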